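(* Let $\tau$ be a finite nonempty set of proposition symbols, $t=2^{|\tau|}$, let $d:\mathbb Z_+\to\mathbb N$ be a function and let $f$ be a positive real-valued function with $f(n)=\omega(\sqrt n)$. If $d(n)\le n/t-f(n)$, then with limit probability one (as $n\to\infty$) two random models of size $n$ cannot be separated in $\mathrm{GMLU}_{d(n)}$. If $d(n)\ge n/t+f(n)$, then with limit probability one (as $n\to\infty$) two random models of size $n$ can be separated in $\mathrm{GMLU}_{d(n)}$.
   Context: Models: a $\tau$-model with domain $W$ assigns to each $p\in\tau$ a subset of $W$ (the points where $p$ is true). For each $n$ there are $2^{n|\tau|}$ $\tau$-models with domain $\{1,\dots,n\}$. Two random models of size $n$ means two models drawn independently and uniformly at random from these $2^{n|\tau|}$ models. Logic: propositional formulas are $\psi ::= p\mid\neg p\mid\psi\wedge\psi\mid\psi\vee\psi$ with $p\in\tau$. Formulas of $\mathrm{GMLU}$ are built from $\diamond^{\ge k}\psi$, $\blacksquare^{<k}\psi$, $\diamond^{=k}\psi$, $\blacksquare^{\ne k}\psi$ ($\psi$ propositional, $k\in\mathbb N$) by closing under $\wedge,\vee$ and under prefixing $\diamond^{\ge k},\blacksquare^{<k},\diamond^{=k},\blacksquare^{\ne k}$. Semantics at a point $w$: Boolean connectives as usual; $\diamond^{\ge k}\varphi$ (resp. $\diamond^{=k}\varphi$) holds iff at least (resp. exactly) $k$ points of the domain satisfy $\varphi$; $\blacksquare^{<k}\varphi$ is equivalent to $\neg\diamond^{\ge k}\neg\varphi$ and $\blacksquare^{\ne k}\varphi$ to $\neg\diamond^{=k}\neg\varphi$.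 Truth of a $\mathrm{GMLU}$-formula in a model does not depend on the point, so $\mathfrak M\vDash\varphi$ is well defined. $\mathrm{GMLU}_d$ is the set of formulas of counting depth at most $d$, i.e. in which every occurring $\diamond^{\ge k},\blacksquare^{<k}$ has $k\le d$ and every occurring $\diamond^{=k},\blacksquare^{\ne k}$ has $k+1\le d$. Two models can be separated in $\mathrm{GMLU}_d$ if some $\mathrm{GMLU}_d$-formula is true in one of them and false in the other. $f=\omega(g)$ means $f(n)/g(n)\to\infty$. *)

(* Defs.v *)
From HB Require Import structures.
From mathcomp Require Import all_boot all_order all_algebra.
From mathcomp Require Import all_classical all_reals all_analysis.
Set Implicit Arguments.
Unset Strict Implicit.
Unset Printing Implicit Defensive.
Import Order.TTheory GRing.Theory Num.Theory.
Import numFieldNormedType.Exports.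
Local Open Scope ring_scope.

(* The domain {1, ..., n} is rendered as 'I_n = {0, ..., n - 1}. *)
Definition model (tau : finType) (n : nat) := {ffun tau -> {set 'I_n}}.

Inductive prop_form (tau : Type) : Type :=
| PVar of tau
| PNegVar of tau
| PAnd of prop_form tau & prop_form tau
| POr of prop_form tau & prop_form tau.

Inductive modality : Type :=
| DiamondGe of nat
| BoxLt of nat
| DiamondEq of nat
| BoxNe of nat.

(* Every atomic proposition lies in the scope of a modality: propositional
   formulas enter only through GBase. *)
Inductive gmlu (tau : Type) : Type :=
| GBase of modality & prop_form tau
| GMod of modality & gmlu tau
| GAnd of gmlu tau & gmlu tau
| GOr of gmlu tau & gmlu tau.

Fixpoint prop_sat (tau : finType) (n : nat) (M : model tau n)
    (psi : prop_form tau) (w : 'I_n) : bool :=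
  match psi with
  | PVar p => w \in M p
  | PNegVar p => w \notin M p
  | PAnd a b => prop_sat M a w && prop_sat M b w
  | POr a b => prop_sat M a w || prop_sat M b w
  end.

Definition modality_sat (n : nat) (o : modality) (P : pred 'I_n) : bool :=
  match o with
  | DiamondGe k => (k <= #|[set v | P v]|)%N
  | BoxLt k => ~~ (k <= #|[set v | ~~ P v]|)%N
  | DiamondEq k => #|[set v | P v]| == k
  | BoxNe k => ~~ (#|[set v | ~~ P v]| == k)
  end.

Fixpoint gmlu_sat (tau : finType) (n : nat) (M : model tau n)
    (phi : gmlu tau) (w : 'I_n) : bool :=
  match phi with
  | GBase o psi => modality_sat o (prop_sat M psi)
  | GMod o a => modality_sat o (gmlu_sat M a)
  | GAnd a b => gmlu_sat M a w && gmlu_sat M b w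
  | GOr a b => gmlu_sat M a w || gmlu_sat M b w
  end.

Lemma gmlu_sat_const (tau : finType) (n : nat) (M : model tau n)
  (phi : gmlu tau) (v w : 'I_n) : gmlu_sat M phi v = gmlu_sat M phi w.
Proof. by elim: phi => //= a -> b ->. Qed.

(* By gmlu_sat_const, on a nonempty domain this is truth at any one point. *)
Definition models (tau : finType) (n : nat) (M : model tau n)
  (phi : gmlu tau) : bool := [forall w, gmlu_sat M phi w].

Lemma modelsE (tau : finType) (n : nat) (M : model tau n) (phi : gmlu tau)
  (w : 'I_n) : models M phi = gmlu_sat M phi w.
Proof.
by apply/forallP/idP => [//|H v]; rewrite (gmlu_sat_const M phi v w).
Qed.

Definition modality_depth (o : modality) : nat :=
  match o with
  | DiamondGe k | BoxLt k => k
  | DiamondEq k | BoxNe k => k.+1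
  end.

Fixpoint counting_depth (tau : Type) (phi : gmlu tau) : nat :=
  match phi with
  | GBase o _ => modality_depth o
  | GMod o a => maxn (modality_depth o) (counting_depth a)
  | GAnd a b | GOr a b => maxn (counting_depth a) (counting_depth b)
  end.

Definition separable (tau : finType) (d m n : nat) (M : model tau m)
    (N : model tau n) : Prop :=
  exists phi : gmlu tau,
    (counting_depth phi <= d)%N /\ models M phi <> models N phi.

Lemma card_model (tau : finType) (n : nat) :
  #|{: model tau n}| = (2 ^ (n * #|tau|))%N.
Proof. by rewrite card_ffun -cardsT -powersetT card_powerset cardsT card_ord expnM. Qed.

(* Probability of E (X, Y) for X and Y independent and uniform on T: the pair
   is then uniform on T * T. *)
Definition pr_pair (R : realType) (T : finType) (E : T -> T -> Prop) : R :=
  #|[set p : T * T | `[< E p.1 p.2 >]]|%:R / #|{: T * T}|%:R.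

(* Main.v *)
Require Import Defs.
From HB Require Import structures.
From mathcomp Require Import all_boot all_order all_algebra.
From mathcomp Require Import all_classical all_reals all_analysis.
From mathcomp Require Import zify ring lra.
Set Implicit Arguments.
Unset Strict Implicit.
Unset Printing Implicit Defensive.
Import Order.TTheory GRing.Theory Num.Theory.
Import numFieldNormedType.Exports.
Local Open Scope ring_scope.

(** Call the set of propositions true at a point the colour of that point. A
model of size n is then a colouring of n points by t = 2^|tau| colours, and
drawing it uniformly means colouring every point uniformly and independently,
so each colour count has mean n/t and standard deviation at most sqrt n.

A propositional formula defines a union of colour classes, and a formula of
counting depth at most d sees a cardinality c only through min(c, d)
([modality_sat_minn]). Two consequences do the logical work.

- If all colour counts in both models are at least d, then every union of
  colour classes is either empty in both models or has at least d points in
  both, so nothing separates them ([large_counts_not_separable]).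

- If all colour counts of one model are below d and the two models differ in
  some colour count, then the smaller of the two differing counts is some
  c < d, and asking for at least c + 1 points of that colour separates them
  ([small_counts_separable]).

When d lies f(n) below or above n/t, the bounds that these facts require of the
colour counts fail only if some count deviates from its mean by at least f(n). By the second moment
bound and a union bound over the t colours this has probability at most
t n / f(n)^2, which tends to 0 since f grows faster than sqrt n
([pr_exists_deviation], [omega_sqrt_cvg0]).

In the second case the models must also be shown to differ in some colour
count. Fix a proposition p: if all colour counts agree, then p is true at
equally many points in both models. Two uniform subsets of an n-element set are
equinumerous with probability C(2n, n) / 4^n, by the Vandermonde convolution,
and this is at most 1 / sqrt(n + 1) ([pr_eq_card], [central_bin_bound]). Using
p instead of one colour keeps the distribution binomial with parameter 1/2,
where the collision probability has a closed form. *)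

(** * Colours of points *)

Definition colour (tau : finType) (n : nat) (M : model tau n) (w : 'I_n) :
  {set tau} := [set p | w \in M p].

Definition colour_count (tau : finType) (n : nat) (M : model tau n)
  (a : {set tau}) : nat := #|[set w | colour M w == a]|.

Fixpoint prop_eval (tau : finType) (psi : prop_form tau) (a : {set tau}) :
    bool :=
  match psi with
  | PVar p => p \in a
  | PNegVar p => p \notin a
  | PAnd x y => prop_eval x a && prop_eval y a
  | POr x y => prop_eval x a || prop_eval y a
  end.

Lemma prop_sat_colour (tau : finType) (n : nat) (M : model tau n)
  (psi : prop_form tau) (w : 'I_n) :
  prop_sat M psi w = prop_eval psi (colour M w).
Proof. by elim: psi => [p|p|a IHa b IHb|a IHa b IHb] /=; rewrite ?inE ?IHa ?IHb. Qed.

(** * What formulas of bounded counting depth can see *)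

(** A bound k <= d compares in the same way with c and with min(c, d), and so
does the test c = k as long as k < d: this is why exact counting by k costs
depth k + 1. The complement is needed for the two box modalities. *)
Lemma modality_sat_minn (n d : nat) (o : modality) (P Q : pred 'I_n) :
  (modality_depth o <= d)%N ->
  minn d #|[set v | P v]| = minn d #|[set v | Q v]| ->
  minn d #|[set v | ~~ P v]| = minn d #|[set v | ~~ Q v]| ->
  modality_sat o P = modality_sat o Q.
Proof. by case: o => k /= kd eqP eqN; apply/idP/idP; lia. Qed.

(** The set of points whose colour satisfies [G] is empty in both models when
[G] is, and otherwise contains a whole colour class in each of them. *)
Lemma minn_card_colour (tau : finType) (n d : nat) (M N : model tau n)
  (G : pred {set tau}) :
  (forall a, (d <= colour_count M a)%N) -> (forall a, (d <= colour_count N a)%N) ->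
  minn d #|[set v | G (colour M v)]| = minn d #|[set v | G (colour N v)]|.
Proof.
move=> dM dN.
have card_ge (K : model tau n) a : G a -> (d <= colour_count K a)%N ->
    (d <= #|[set v | G (colour K v)]|)%N.
  move=> Ga /leq_trans; apply; apply: subset_leq_card.
  by apply/fintype.subsetP => v; rewrite !inE => /eqP ->.
have [a Ga|G0] := pickP G.
  by rewrite !(minn_idPl _) ?(card_ge _ a).
by congr (minn d _); apply: eq_card => v; rewrite !inE !G0.
Qed.

(** Propositional extensions and their complements are unions of colour
classes, so [minn_card_colour] settles the innermost modalities. An outer
modality counts the points satisfying a sentence, and that sentence has by
induction the same extension in both models. *)
Lemma large_counts_not_separable (tau : finType) (n d : nat)
  (M N : model tau n) :
  (forall a, (d <= colour_count M a)%N) -> (forall a, (d <= colour_count N a)%N) ->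
  ~ separable d M N.
Proof.
move=> dM dN [phi [phid]]; apply.
suff sat_eq (w : 'I_n) : gmlu_sat M phi w = gmlu_sat N phi w.
  by apply: eq_forallb.
elim: phi phid w => [m psi|m a IHa|a IHa b IHb|a IHa b IHb] /=.
- move=> md w; apply: (modality_sat_minn md).
  + under eq_finset do rewrite prop_sat_colour.
    under [in RHS]eq_finset do rewrite prop_sat_colour.
    exact: minn_card_colour.
  + under eq_finset do rewrite prop_sat_colour.
    under [in RHS]eq_finset do rewrite prop_sat_colour.
    exact: (minn_card_colour (fun a => ~~ prop_eval psi a)).
- rewrite geq_max => /andP[md ad] w.
  by have /boolp.funext -> : gmlu_sat M a =1 gmlu_sat N a by exact: IHa.
- by rewrite geq_max => /andP[ad bd] w; rewrite IHa ?IHb.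
- by rewrite geq_max => /andP[ad bd] w; rewrite IHa ?IHb.
Qed.

(** * Separating models with different colour counts *)

Definition literal (tau : finType) (a : {set tau}) (p : tau) : prop_form tau :=
  if p \in a then PVar p else PNegVar p.

(** The syntax has no constant for truth, so the conjunction of all literals is
seeded with the literal of some given proposition [p0]. *)
Definition colour_form (tau : finType) (p0 : tau) (a : {set tau}) :
    prop_form tau :=
  foldr (fun p => PAnd (literal a p)) (literal a p0) (enum tau).

Lemma prop_eval_colour_form (tau : finType) (p0 : tau) (a b : {set tau}) :
  prop_eval (colour_form p0 a) b = (b == a).
Proof.
have litE p : prop_eval (literal a p) b = ((p \in b) == (p \in a)).
  by rewrite /literal; case: ifP => /= _; case: (_ \in b).
have foldE (s : seq tau) :
    prop_eval (foldr (fun p => PAnd (literal a p)) (literal a p0) s) b =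
    all (fun p => (p \in b) == (p \in a)) (rcons s p0).
  by elim: s => [|p s /= ->] /=; rewrite litE ?andbT.
rewrite foldE; apply/allP/eqP => [eq_ab|-> //].
by apply/finset.setP => p; apply/eqP/eq_ab; rewrite mem_rcons inE mem_enum orbT.
Qed.

Lemma separable_sym (tau : finType) (m n d : nat) (M : model tau m)
  (N : model tau n) : separable d M N -> separable d N M.
Proof. by case=> phi [phid neq]; exists phi; split=> // /esym. Qed.

Lemma separable_colour_count_lt (tau : finType) (n d : nat) (p0 : tau)
  (M N : model tau n) (a : {set tau}) :
  (colour_count M a < colour_count N a)%N -> (colour_count M a < d)%N ->
  separable d M N.
Proof.
move=> ltMN Md.
have [w _] : exists w, w \in [set w | colour N w == a].
  by apply/finset.set0Pn; rewrite -card_gt0; apply: leq_ltn_trans ltMN.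
exists (GBase (DiamondGe (colour_count M a).+1) (colour_form p0 a)).
split=> //; rewrite !(modelsE _ _ w) /=.
have countE (K : model tau n) :
    #|[set v | prop_sat K (colour_form p0 a) v]| = colour_count K a.
  by apply: eq_card => v; rewrite !inE prop_sat_colour prop_eval_colour_form.
by rewrite !countE ltnn ltMN.
Qed.

Lemma card_model_colour_count (tau : finType) (n : nat) (M : model tau n)
  (p : tau) : #|M p| = (\sum_(a : {set tau} | p \in a) colour_count M a)%N.
Proof.
rewrite -sum1_card (partition_big (colour M) (fun a => p \in a)) => [|w].
  apply: eq_bigr => a pa; rewrite sum1dep_card; apply: eq_card => w.
  by rewrite !inE andb_idl // => /eqP wa; rewrite -wa inE in pa.
by rewrite inE.
Qed.

(** The points where [p] holds form a union of colour classes, so some colour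
count differs. A bound on the counts of [M] alone suffices: a count of [N] below
a count of [M] is below [d] as well. *)
Lemma small_counts_separable (tau : finType) (n d : nat) (p : tau)
  (M N : model tau n) :
  (forall a, (colour_count M a < d)%N) -> #|M p| <> #|N p| -> separable d M N.
Proof.
move=> Md neqMN.
have [eqMN|] := boolP [forall a, colour_count M a == colour_count N a].
  case: neqMN; rewrite !card_model_colour_count.
  by apply: eq_bigr => a _; apply/eqP/(forallP eqMN).
rewrite negb_forall => /existsP[a]; rewrite neq_ltn => /orP[lt|lt].
  exact: separable_colour_count_lt lt (Md a).
exact/separable_sym/(separable_colour_count_lt p lt)/(ltn_trans lt).
Qed.

(** * Probabilities over pairs *)

Lemma pr_pairE (R : realType) (T : finType) (E : T -> T -> Prop) :
  pr_pair R E =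
  (\sum_x \sum_y (`[< E x y >] : nat)%:R) / #|{: T}|%:R ^+ 2.
Proof.
rewrite /pr_pair card_prod natrM -expr2 pair_bigA /=; congr (_ / _).
rewrite -sum1_card natr_sum [LHS]big_mkcond.
by apply: eq_bigr => q _; rewrite inE; case: ifP.
Qed.

Lemma ler_pr_pair (R : realType) (T : finType) (E F : T -> T -> Prop) :
  (forall x y, E x y -> F x y) -> pr_pair R E <= pr_pair R F.
Proof.
move=> EF; rewrite ler_wpM2r ?invr_ge0 ?ler_nat //; apply: subset_leq_card.
apply/fintype.subsetP => q; rewrite !inE; exact: EF.
Qed.

Lemma pr_pair_or (R : realType) (T : finType) (E F : T -> T -> Prop) :
  pr_pair R (fun x y => E x y \/ F x y) <= pr_pair R E + pr_pair R F.
Proof.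
rewrite -mulrDl ler_wpM2r ?invr_ge0 // -natrD ler_nat.
apply: leq_trans (leq_card_setU _ _).
apply/subset_leq_card/fintype.subsetP => q; rewrite !inE.
by case=> [Eq|Fq]; apply/orP; [left|right]; apply: asboolT.
Qed.

Lemma pr_pair_exists (R : realType) (I T : finType) (E : I -> T -> T -> Prop) :
  pr_pair R (fun x y => exists i, E i x y) <= \sum_i pr_pair R (E i).
Proof.
rewrite -mulr_suml ler_wpM2r ?invr_ge0 // -natr_sum ler_nat.
apply: (@leq_trans #|\bigcup_i [set q : T * T | `[< E i q.1 q.2 >]]|).
  apply/subset_leq_card/fintype.subsetP => q; rewrite !inE => -[i Ei].
  by apply/finset.bigcupP; exists i => //; rewrite inE; apply: asboolT.
elim/big_rec2: _ => [|i A k _ le_A]; first by rewrite cards0.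
by rewrite (leq_trans (leq_card_setU _ _)) // leq_add2l.
Qed.

Lemma pr_pair_not (R : realType) (T : finType) (E : T -> T -> Prop) :
  (0 < #|{: T}|)%N ->
  pr_pair R E = 1 - pr_pair R (fun x y => ~ E x y).
Proof.
move=> T0; apply/eqP; rewrite eq_sym subr_eq -mulrDl -natrD; apply/eqP.
rewrite (_ : (_ + _)%N = #|{: T * T}|).
  by rewrite divff // pnatr_eq0 card_prod muln_eq0 orbb -lt0n.
rewrite -[RHS](cardsC [set q : T * T | `[< E q.1 q.2 >]]); congr (_ + _)%N.
by apply: eq_card => q; rewrite finset.in_setC !finset.in_set asbool_neg.
Qed.

Lemma pr_pair_sym (R : realType) (T : finType) (E : T -> T -> Prop) :
  pr_pair R E = pr_pair R (fun x y => E y x).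
Proof. by rewrite !pr_pairE exchange_big. Qed.

Lemma pr_pair_le1 (R : realType) (T : finType) (E : T -> T -> Prop) :
  (0 < #|{: T}|)%N -> pr_pair R E <= 1.
Proof. by move=> T0; rewrite (pr_pair_not _ _ T0) gerBl divr_ge0. Qed.

(** * Concentration of colour counts *)

Lemma card_set_type (T : finType) : #|{: {set T}}| = (2 ^ #|T|)%N.
Proof. by rewrite -[#|T|]cardsT -card_powerset powersetT cardsT. Qed.

Lemma pr_pair_fst (R : realType) (T : finType) (P : pred T) :
  (0 < #|{: T}|)%N -> pr_pair R (fun x _ => P x) = #|P|%:R / #|{: T}|%:R.
Proof.
move=> T0; rewrite pr_pairE.
have nz : (#|{: T}|%:R : R) != 0 by rewrite pnatr_eq0 -lt0n.
have -> : \sum_x \sum_(y : T) (`[< P x >] : nat)%:R = #|P|%:R * #|{: T}|%:R :> R.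
  rewrite -[in RHS]sum1_card natr_sum mulr_suml [RHS]big_mkcond.
  apply: eq_bigr => x _; rewrite sumr_const asboolb unfold_in.
  by case: (P x); rewrite ?mul0rn ?mul1r.
by field.
Qed.

(** The value at [i] of a uniform function is uniform: the sum is a product
over the domain in which every factor but the one at [i] is #|T|. *)
Lemma sum_ffun_eval (R : realType) (I T : finType) (i : I) (g : T -> R) :
  (\sum_(h : {ffun I -> T}) g (h i)) * #|{: T}|%:R =
  #|{ffun I -> T}|%:R * \sum_x g x.
Proof.
pose F (k : I) x := if k == i then g x else 1.
have -> : \sum_(h : {ffun I -> T}) g (h i) =
    \sum_(h : {ffun I -> T}) \prod_k F k (h k).
  apply: eq_bigr => h _; rewrite (bigD1 i) //= big1 ?mulr1 => [|k ki].
    by rewrite /F eqxx.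
  by rewrite /F (negPf ki).
rewrite -bigA_distr_bigA (bigD1 i) //= {1}/F eqxx.
rewrite card_ffun (cardD1 i) inE /= add1n expnS natrM.
have -> : \prod_(k | k != i) \sum_x F k x =
    \prod_(k | k != i) #|{: T}|%:R :> R.
  by apply: eq_bigr => k ki; rewrite /F (negPf ki) sumr_const.
rewrite prodr_const natrX.
rewrite (_ : #|[pred x | x != i]| = #|[predD1 I & i]|); first by ring.
by apply: eq_card => k; rewrite !inE andbT.
Qed.

(** Centred functions of two different coordinates are uncorrelated, since the
coordinates of a uniform function are independent. *)
Lemma sum_ffun_eval2 (R : realType) (I T : finType) (i j : I) (y : T -> R) :
  i != j -> \sum_x y x = 0 -> \sum_(h : {ffun I -> T}) y (h i) * y (h j) = 0.
Proof.
move=> ij y0.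
pose F (k : I) x := if (k == i) || (k == j) then y x else 1.
have -> : \sum_(h : {ffun I -> T}) y (h i) * y (h j) =
    \sum_(h : {ffun I -> T}) \prod_k F k (h k).
  apply: eq_bigr => h _; rewrite (bigD1 i) //= (bigD1 j) 1?eq_sym //=.
  rewrite big1 ?mulr1 => [|k /andP[ki kj]].
    by rewrite /F !eqxx orbT.
  by rewrite /F (negPf ki) (negPf kj).
by rewrite -bigA_distr_bigA (bigD1 i) //= /F eqxx y0 mul0r.
Qed.

(** The variance of a sum of independent centred terms is the sum of their
variances: the off-diagonal part of the expanded square vanishes. *)
Lemma sum_ffun_sqr (R : realType) (I T : finType) (y : T -> R) :
  (forall x, `|y x| <= 1) -> \sum_x y x = 0 ->
  \sum_(h : {ffun I -> T}) (\sum_i y (h i)) ^+ 2 <=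
  #|{: I}|%:R * #|{ffun I -> T}|%:R.
Proof.
move=> y1 y0.
under eq_bigr => h _ do rewrite expr2 mulr_suml.
rewrite exchange_big mulr_natl -sumr_const ler_sum //= => i _.
under eq_bigr => h _ do rewrite mulr_sumr.
rewrite exchange_big (bigD1 i) //= [X in _ + X]big1 => [|j ji].
  rewrite addr0 -sumr_const ler_sum //= => h _.
  by rewrite -expr2 -real_normK ?num_real // expr_le1.
by apply: sum_ffun_eval2; rewrite // eq_sym.
Qed.

(** Chebyshev's inequality for the number of points with value [a], applied to
the centred indicator x |-> [x = a] - 1 / #|T|. *)
Lemma card_deviation (R : realType) (I T : finType) (a : T) (e : R) :
  0 <= e ->
  #|[set h : {ffun I -> T} |
      e <= `| #|[set i | h i == a]|%:R - #|{: I}|%:R / #|{: T}|%:R | ]|%:R *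
    e ^+ 2 <= #|{: I}|%:R * #|{ffun I -> T}|%:R.
Proof.
move=> e0; have T0 : (0 < #|{: T}|)%N by apply/card_gt0P; exists a.
set t : R := #|{: T}|%:R; have t1 : 1 <= t by rewrite ler1n.
have t0 : t != 0 by rewrite lt0r_neq0 // (lt_le_trans _ t1).
pose y x : R := (x == a)%:R - t^-1.
have tV : 0 <= t^-1 <= 1.
  by rewrite invr_ge0 (le_trans _ t1) //= invf_le1 // (lt_le_trans _ t1).
have y1 x : `|y x| <= 1.
  case/andP: tV => tV0 tV1; rewrite /y ler_norml.
  by case: (x == a); rewrite ?mulr1n ?mulr0n; lra.
have y0 : \sum_x y x = 0.
  rewrite sumrB sumr_const -mulr_natl divff // (bigD1 a) //= eqxx.
  by rewrite big1 ?addr0 ?subrr // => x /negPf ->.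
have sumE (h : {ffun I -> T}) :
    \sum_i y (h i) = #|[set i | h i == a]|%:R - #|{: I}|%:R / t.
  rewrite sumrB sumr_const -[t^-1 *+ _]mulr_natl; congr (_ - _).
  rewrite -sum1_card natr_sum [RHS]big_mkcond; apply: eq_bigr => i _.
  by rewrite inE; case: eqP.
apply: le_trans (sum_ffun_sqr I y1 y0).
rewrite mulr_natl -sumr_const big_mkcond ler_sum //= => h _.
rewrite inE sumE; case: ifP => [le_e|_]; last exact: sqr_ge0.
by rewrite -[leRHS]real_normK ?num_real // ler_pXn2r ?nnegrE.
Qed.

Definition colouring (tau : finType) (n : nat) (M : model tau n) :
  {ffun 'I_n -> {set tau}} := [ffun w => colour M w].

(** Hence the colours of the points of a uniform model are uniform and
independent. *)
Lemma colouring_bij (tau : finType) (n : nat) : bijective (@colouring tau n).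
Proof.
exists (fun h : {ffun 'I_n -> {set tau}} =>
  [ffun p => [set w | p \in h w]] : model tau n) => [M|h].
  by apply/ffunP => p; apply/finset.setP => w; rewrite !ffunE !inE !ffunE inE.
by apply/ffunP => w; apply/finset.setP => p; rewrite !ffunE !inE !ffunE inE.
Qed.

Lemma card_model_gt0 (tau : finType) (n : nat) : (0 < #|{: model tau n}|)%N.
Proof. by rewrite card_model expn_gt0. Qed.

Lemma pr_colour_count_deviation (R : realType) (tau : finType) (n : nat)
  (a : {set tau}) (e : R) :
  0 < e ->
  pr_pair R (fun M _ : model tau n =>
    e <= `| (colour_count M a)%:R - n%:R / (2 ^ #|tau|)%N%:R |) <=
  n%:R / e ^+ 2.
Proof.
move=> e0; rewrite pr_pair_fst ?card_model_gt0 // ler_pdivrMr ?ltr0n ?card_model_gt0 //.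
rewrite mulrAC ler_pdivlMr ?exprn_gt0 //.
have cardE := card_set_type tau.
have := card_deviation 'I_n a (ltW e0); rewrite card_ord cardE.
rewrite -(bij_eq_card (colouring_bij tau n)).
congr (_%:R * _ <= _).
rewrite -(on_card_preimset (onW_bij _ (colouring_bij tau n))).
apply: eq_card => M; rewrite !inE; congr (_ <= `| _%:R - _ |).
by apply: eq_card => w; rewrite !inE ffunE.
Qed.

(** * Anti-concentration: two random subsets rarely have equal size *)

(** The number of pairs of equinumerous subsets is the sum over k of
C(n, k) C(n, n - k), to which the Vandermonde convolution applies. *)
Lemma sum_eq_card_sets (I : finType) :
  (\sum_(A : {set I}) \sum_(B : {set I}) (#|A| == #|B|))%N =
  'C(#|{: I}|.*2, #|{: I}|).
Proof.
set n := #|{: I}|.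
have sumB (A : {set I}) : (\sum_(B : {set I}) (#|A| == #|B|))%N = 'C(n, #|A|).
  rewrite -card_draws -[RHS]sum1_card [RHS]big_mkcond.
  by apply: eq_bigr => B _; rewrite inE eq_sym; case: eqP.
under eq_bigr => A _ do rewrite sumB.
have cardP (A : {set I}) : (#|A| < n.+1)%N by rewrite ltnS max_card.
rewrite (partition_big (fun A => Ordinal (cardP A)) xpredT) //=.
rewrite -addnn -binomial.Vandermonde; apply: eq_bigr => k _.
rewrite bin_sub ?leq_ord // -card_draws -sum_nat_const.
apply: eq_big => [A|A /eqP <-//]; first by rewrite inE -val_eqE.
by rewrite card_draws.
Qed.

Lemma central_bin_recurrence (n : nat) :
  (n.+1 * 'C(n.+1.*2, n.+1) = 2 * (n.*2.+1 * 'C(n.*2, n)))%N.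
Proof.
have := mul_bin_diag n.+1.*2 n; have := mul_bin_down n.*2.+1 n.
by rewrite doubleS /=; nia.
Qed.

(** The inductive argument gives the stronger factor 2n + 1, because the
recurrence multiplies C(2n, n)^2 / 16^n by ((2n + 1) / (2n + 2))^2, and
(2n + 3) (2n + 1) <= (2n + 2)^2. *)
Lemma central_bin_bound (n : nat) :
  (n.+1 * 'C(n.*2, n) ^ 2 <= 16 ^ n)%N.
Proof.
suff: (n.*2.+1 * 'C(n.*2, n) ^ 2 <= 16 ^ n)%N by apply: leq_trans; nia.
elim: n => [//|n IHn].
have := central_bin_recurrence n; rewrite (expnS 16).
move: 'C(n.+1.*2, n.+1) 'C(n.*2, n) (16 ^ n)%N IHn => x c s IHn rec.
rewrite -(leq_pmul2l (m := n.+1 ^ 2)) ?expn_gt0 //.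
have -> : (n.+1 ^ 2 * (n.+1.*2.+1 * x ^ 2) =
   4 * (n.+1.*2.+1 * n.*2.+1) * (n.*2.+1 * c ^ 2))%N.
  have -> : (n.+1 ^ 2 * (n.+1.*2.+1 * x ^ 2) = n.+1.*2.+1 * (n.+1 * x) ^ 2)%N by ring.
  by rewrite rec; ring.
have -> : (n.+1 ^ 2 * (16 * s) = 4 * (n.+1.*2 ^ 2) * s)%N by rewrite -mul2n; ring.
by apply: leq_mul => //; rewrite leq_mul2l /=; nia.
Qed.

(** The proposition [p] reads off one coordinate of each model, hence compares
two independent uniform subsets of the domain. *)
Lemma pr_eq_card (R : realType) (tau : finType) (n : nat) (p : tau) :
  pr_pair R (fun M N : model tau n => #|M p| = #|N p|) =
  'C(n.*2, n)%:R / 4 ^+ n.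
Proof.
rewrite pr_pairE.
under eq_bigr => M _ do under eq_bigr => N _ do
  rewrite (asbool_equiv_eq (rwP eqP)) asboolb.
have powE : #|{: {set 'I_n}}| = (2 ^ n)%N by rewrite card_set_type card_ord.
have nz : ((2 ^ n)%N%:R : R) != 0 by rewrite pnatr_eq0 -lt0n expn_gt0.
have mz : (#|{: model tau n}|%:R : R) != 0 by rewrite pnatr_eq0 -lt0n card_model_gt0.
have evalE (g : {set 'I_n} -> R) : \sum_(M : model tau n) g (M p) =
    #|{: model tau n}|%:R / (2 ^ n)%N%:R * \sum_A g A.
  apply: (mulIf nz); rewrite -[in LHS]powE sum_ffun_eval.
  by field.
rewrite (evalE (fun A => \sum_(N : model tau n) (#|A| == #|N p| : nat)%:R)).
under eq_bigr => A _ do rewrite (evalE (fun B => (#|A| == #|B| : nat)%:R)) -natr_sum.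
rewrite -mulr_sumr -natr_sum sum_eq_card_sets card_ord.
have -> : 4 ^+ n = (2 ^ n)%N%:R ^+ 2 :> R.
  by rewrite natrX exprAC; congr (_ ^+ n); ring.
by field; rewrite nz mz.
Qed.

(** * Limits *)

Local Open Scope classical_set_scope.
Local Open Scope ring_scope.

Lemma pr_pair_cvg1 (R : realType) (T : nat -> finType)
  (E : forall n, T n -> T n -> Prop) (eps : nat -> R) :
  (forall n, (0 < #|{: T n}|)%N) ->
  (forall n, (0 < n)%N -> pr_pair R (fun x y => ~ E n x y) <= eps n) ->
  eps n @[n --> \oo] --> (0 : R) ->
  pr_pair R (E n) @[n --> \oo] --> (1 : R).
Proof.
move=> T0 leE eps0.
apply: (@squeeze_cvgr _ _ _ _ (fun n => 1 - eps n) (fun=> 1)); last exact: cvg_cst.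
  near=> n; have n0 : (0 < n)%N by near: n; exact: nbhs_infty_gt.
  rewrite pr_pair_le1 ?T0 // andbT (pr_pair_not _ _ (T0 n)).
  by rewrite lerD2l lerN2 leE.
by rewrite -[X in _ --> X]subr0; apply: cvgB => //; exact: cvg_cst.
Unshelve. all: by end_near. Qed.

Lemma omega_sqrt_cvg0 (R : realType) (f : nat -> R) :
  (forall n, (0 < n)%N -> 0 < f n) ->
  f n / Num.sqrt n%:R @[n --> \oo] --> +oo ->
  n%:R / f n ^+ 2 @[n --> \oo] --> (0 : R).
Proof.
move=> f0 fy; pose q n := f n / Num.sqrt n%:R.
have q0 : \forall n \near \oo, 0 < q n.
  near=> n; have n0 : (0 < n)%N by near: n; exact: nbhs_infty_gt.
  by rewrite divr_gt0 ?sqrtr_gt0 ?ltr0n ?f0.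
have qV : (q n)^-1 @[n --> \oo] --> (0 : R) by apply/(gtr0_cvgV0 (f := q)).
rewrite -[X in _ --> X](mulr0 0); apply: cvg_trans (cvgM qV qV).
apply: near_eq_cvg.
near=> n; rewrite /q /= invf_div mulf_div -!expr2 sqr_sqrtr ?ler0n //.
Unshelve. all: by end_near. Qed.

Lemma pr_eq_card_cvg0 (R : realType) (tau : finType) (p : tau) :
  pr_pair R (fun M N : model tau n => #|M p| = #|N p|) @[n --> \oo] -->
  (0 : R).
Proof.
apply: (@squeeze_cvgr _ _ _ _ (fun=> 0) (fun n => Num.sqrt (harmonic n))).
- near=> n; rewrite divr_ge0 //= pr_eq_card.
  rewrite -[leLHS]ger0_norm ?divr_ge0 ?exprn_ge0 // -sqrtr_sqr ler_sqrt //=.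
  rewrite expr_div_n -exprM mulnC exprM ler_pdivrMr ?exprn_gt0 //.
  rewrite mulrC ler_pdivlMr ?ltr0n // (_ : 4 ^+ 2 = 16%:R) -?natrX -?natrM ?ler_nat.
    by rewrite mulnC central_bin_bound.
  by ring.
- exact: cvg_cst.
- rewrite -[X in _ --> X]sqrtr0; apply: continuous_cvg; last exact: cvg_harmonic.
  exact: sqrt_continuous.
Unshelve. all: by end_near. Qed.

Lemma pr_exists_deviation (R : realType) (tau : finType) (n : nat) (e : R) :
  0 < e ->
  pr_pair R (fun M _ : model tau n => exists a,
    e <= `| (colour_count M a)%:R - n%:R / (2 ^ #|tau|)%N%:R |) <=
  (2 ^ #|tau|)%N%:R * (n%:R / e ^+ 2).
Proof.
move=> e0; apply: le_trans (pr_pair_exists _ _) _.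
apply: le_trans (ler_sum _ (fun a _ => pr_colour_count_deviation n a e0)) _.
by rewrite sumr_const card_set_type [leRHS]mulr_natl.
Qed.

Theorem corollary5p9 (R : realType) (tau : finType) (tau_nonempty : (0 < #|tau|)%N)
    (d : nat -> nat) (f : nat -> R)
    (f_pos : forall n : nat, (0 < n)%N -> 0 < f n)
    (f_omega : f n / Num.sqrt n%:R @[n --> \oo] --> +oo) :
  let t : R := (2 ^ #|tau|)%N%:R in
  ((forall n : nat, (0 < n)%N -> (d n)%:R <= n%:R / t - f n) ->
     pr_pair R (fun M N : model tau n => ~ separable (d n) M N) @[n --> \oo]
       --> (1 : R)) /\
  ((forall n : nat, (0 < n)%N -> n%:R / t + f n <= (d n)%:R) ->
     pr_pair R (fun M N : model tau n => separable (d n) M N) @[n --> \oo]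
       --> (1 : R)).
Proof.
move=> t; pose dev n (M : model tau n) :=
  exists a, f n <= `| (colour_count M a)%:R - n%:R / t |.
have dev_le n : (0 < n)%N ->
    pr_pair R (fun M _ : model tau n => dev n M) <= t * (n%:R / f n ^+ 2).
  by move=> n0; apply/pr_exists_deviation/f_pos.
have dev0 : t * (n%:R / f n ^+ 2) @[n --> \oo] --> (0 : R).
  by rewrite -[X in _ --> X](mulr0 t); apply: cvgM;
     [exact: cvg_cst|exact: omega_sqrt_cvg0].
split=> hd.
- apply: (@pr_pair_cvg1 R (fun n => model tau n) (fun n M N => ~ separable (d n) M N)
    (fun n => t * (n%:R / f n ^+ 2) + t * (n%:R / f n ^+ 2))).
  + by move=> n; exact: card_model_gt0.
  (* Separable models: one of the two has a count deviating by f n. *)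
  + move=> n n0; apply: le_trans (lerD (dev_le n n0) (dev_le n n0)).
    rewrite [X in _ + X]pr_pair_sym; apply: le_trans (pr_pair_or _ _ _).
    have small (M : model tau n) : ~ dev n M ->
        forall a, (d n <= colour_count M a)%N.
      move=> ndev a; rewrite leqNgt; apply/negP => lt_d; apply: ndev; exists a.
      rewrite distrC ler_normr; apply/orP; left.
      by move: (hd n n0) lt_d; rewrite -(ltr_nat R); lra.
    apply: ler_pr_pair => M N sepMN; apply: contrapT => /not_orP[/small dM /small dN].
    by apply: sepMN; exact: large_counts_not_separable.
  + by rewrite -[X in _ --> X]addr0; exact: cvgD.
- have /card_gt0P[p _] := tau_nonempty.
  apply: (@pr_pair_cvg1 R (fun n => model tau n) (fun n M N => separable (d n) M N)
    (fun n => t * (n%:R / f n ^+ 2) +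
       pr_pair R (fun M N : model tau n => #|M p| = #|N p|))).
  + by move=> n; exact: card_model_gt0.
  (* Inseparable models: M has a deviating count, or p cannot tell M from N. *)
  + move=> n n0; apply: le_trans (lerD (dev_le n n0) (lexx _)).
    apply: le_trans (pr_pair_or _ _ _).
    apply: ler_pr_pair => M N sepMN; apply: contrapT => /not_orP[ndev neqMN].
    apply: sepMN; apply: (small_counts_separable (p := p)) => // a.
    rewrite ltnNge; apply/negP => le_d; apply: ndev; exists a.
    rewrite ler_normr; apply/orP; left.
    by move: (hd n n0) le_d; rewrite -(ler_nat R); lra.
  + by rewrite -[X in _ --> X]addr0; apply: cvgD => //; exact: pr_eq_card_cvg0.
Qed.
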